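(* Let $\mathcal{X}$ be a left closed monoidal category with finite products, and let $\mathcal{C}$ be a cocartesian monoidal category. Let there be a strong action of $\mathcal{X}$ on $\mathcal{C}$. Assume that there is a functor \[ (- \rhd -) \colon \mathcal{C}^{\mathrm{op}} \times \mathcal{C} \to \mathcal{X} \] and a natural isomorphism of hom sets \[ \mathcal{C}(B^X, C) \cong \mathcal{X}(X, B \rhd C) \] (for objects $X$ of $\mathcal{X}$ and $B, C$ of $\mathcal{C}$). Then the semidirect product monoidal category $\mathcal{X} \ltimes \mathcal{C}$ is left closed, with internal hom defined by \[ [\langle X, A \rangle, \langle Z, C \rangle] = \langle [X, Z] \times (A \rhd C), C \rangle, \] where $[X,Z]$ is the internal hom of $\mathcal{X}$.
   Context: In a monoidal category the structure isomorphisms are directed as $\alpha_{A,B,C} \colon A \otimes (B \otimes C) \to (A \otimes B) \otimes C$, $\lambda_A \colon A \to \mathcal{I} \otimes A$, $\rho_A \colon A \otimes \mathcal{I} \to A$. An object's name also denotes its identity morphism. A monoidal category $\mathcal{M}$ is left closed if, for every object $A$, tensoring on the left $A \otimes (-)$ has a right adjoint, denoted $[A,-]$ (the internal hom), so that there are natural isomorphisms $\mathcal{M}(A \otimes B, C) \cong \mathcal{M}(B, [A,C])$. A cocartesian monoidal category is a category with finite coproducts regarded as a monoidal category with tensor product the coproduct $+$ and unit the initial object. Strong action of $\mathcal{X}$ on $\mathcal{C}$: a strong monoidal functor $\Gamma$ from $\mathcal{X}$ to $[\mathcal{C},\mathcal{C}]$, the strict monoidal category of strong monoidal endofunctors of $\mathcal{C}$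 and monoidal natural transformations, with tensor product given by functor composition in diagrammatic order. For an object $X$ (morphism $f$) of $\mathcal{X}$, write $(-)^X$ (respectively $(-)^f$) for $\Gamma(X)$ (respectively $\Gamma(f)$). The structure isomorphisms of the strong monoidal functor $(-)^X$ are $\varphi^X_{B,C} \colon B^X \otimes C^X \to (B \otimes C)^X$ and $\varphi^X \colon \mathcal{I}_{\mathcal{C}} \to \mathcal{I}_{\mathcal{C}}^X$. The structure isomorphisms of $\Gamma$, in the oplax direction, are monoidal natural isomorphisms with components $\psi^{X,Y}_C \colon C^{X \otimes Y} \to (C^X)^Y$ and $\psi_C \colon C^{\mathcal{I}_{\mathcal{X}}} \to C$. Semidirect product $\mathcal{X} \ltimes \mathcal{C}$ (a monoidal category): the underlying category is $\mathcal{X} \times \mathcal{C}$, with objects written $\langle X, C \rangle$. The tensor product is $\langle X, B \rangle \otimes \langle Y, C \rangle = \langle X \otimes Y, B^Y \otimes C \rangle$ (and correspondingly on morphisms), which for cocartesian $\mathcal{C}$ reads $\langle X \otimes Y, B^Y + C \rangle$, and the unit is $\langle \mathcal{I}_{\mathcal{X}}, \mathcal{I}_{\mathcal{C}} \rangle$. The structure maps are given by their components in $\mathcal{X}$ and in $\mathcal{C}$. Their $\mathcal{X}$-components are the structure maps $\alpha_{X,Y,Z}$, $\lambda_X$, $\rho_X$ of $\mathcal{X}$. Their $\mathcal{C}$-components are: for $\alpha_{\langle X,A \rangle, \langle Y,B \rangle, \langle Z,C \rangle}$, the composite $(\varphi^Z_{A^Y,B} \otimes C) \circ \alpha_{(A^Y)^Z,B^Z,C}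 \circ (\psi^{Y,Z}_A \otimes (B^Z \otimes C)) \colon A^{Y \otimes Z} \otimes (B^Z \otimes C) \to (A^Y \otimes B)^Z \otimes C$; for $\lambda_{\langle X,C \rangle}$, the composite $(\varphi^X \otimes C) \circ \lambda_C \colon C \to \mathcal{I}_{\mathcal{C}}^X \otimes C$; for $\rho_{\langle X,C \rangle}$, the composite $\rho_C \circ (\psi_C \otimes \mathcal{I}_{\mathcal{C}}) \colon C^{\mathcal{I}_{\mathcal{X}}} \otimes \mathcal{I}_{\mathcal{C}} \to C$. *)

(* Defs.v *)
(** Hom sets carry Leibniz equality, so functional extensionality and proof
    irrelevance are needed to compare natural transformations componentwise. *)

From Stdlib Require Import ssreflect ssrfun FunctionalExtensionality ProofIrrelevance.

Set Implicit Arguments.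
Unset Strict Implicit.
Unset Printing Implicit Defensive.

Declare Scope cat_scope.
Delimit Scope cat_scope with cat.
Local Open Scope cat_scope.

Reserved Notation "A ~> B" (at level 70, no associativity).
Reserved Notation "g ∘ f" (at level 40, left associativity).
Reserved Notation "A ⊗ B" (at level 35, right associativity).
Reserved Notation "f ⊠ g" (at level 35, right associativity).

Record Category := {
  Ob :> Type;
  Hom : Ob -> Ob -> Type;
  idn : forall A, Hom A A;
  comp : forall A B C, Hom B C -> Hom A B -> Hom A C;
  comp_idl : forall A B (f : Hom A B), comp (idn B) f = f;
  comp_idr : forall A B (f : Hom A B), comp f (idn A) = f;
  comp_assoc : forall A B C D (h : Hom C D) (g : Hom B C) (f : Hom A B),
    comp h (comp g f) = comp (comp h g) f
}.
Arguments Hom {c} _ _.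
Arguments idn {c} A.
Arguments comp {c A B C} _ _.

Notation "A ~> B" := (Hom A B) : cat_scope.
Notation "g ∘ f" := (comp g f) : cat_scope.

Record Iso (C : Category) (A B : C) := {
  fwd :> A ~> B;
  bwd : B ~> A;
  fwd_bwd : fwd ∘ bwd = idn B;
  bwd_fwd : bwd ∘ fwd = idn A
}.
Arguments Iso {C} A B.

Definition opcat (C : Category) : Category := {|
  Ob := Ob C;
  Hom := fun A B => @Hom C B A;
  idn := fun A => @idn C A;
  comp := fun A B D g f => @comp C D B A f g;
  comp_idl := fun A B f => comp_idr f;
  comp_idr := fun A B f => comp_idl f;
  comp_assoc := fun A B D E h g f => eq_sym (comp_assoc f g h)
|}.

Lemma prodcat_idl (C D : Category) (P Q : C * D)
    (f : (P.1 ~> Q.1) * (P.2 ~> Q.2)) :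
  (idn Q.1 ∘ f.1, idn Q.2 ∘ f.2) = f.
Proof. by rewrite !comp_idl; case: f. Qed.

Lemma prodcat_idr (C D : Category) (P Q : C * D)
    (f : (P.1 ~> Q.1) * (P.2 ~> Q.2)) :
  (f.1 ∘ idn P.1, f.2 ∘ idn P.2) = f.
Proof. by rewrite !comp_idr; case: f. Qed.

Definition prodcat (C D : Category) : Category.
Proof.
refine {|
  Ob := (Ob C * Ob D)%type;
  Hom := fun P Q => ((P.1 ~> Q.1) * (P.2 ~> Q.2))%type;
  idn := fun P => (idn P.1, idn P.2);
  comp := fun P Q R g f => (g.1 ∘ f.1, g.2 ∘ f.2);
  comp_idl := fun P Q f => prodcat_idl f;
  comp_idr := fun P Q f => prodcat_idr f
|}.
abstract (by move=> P Q R S h g f /=; rewrite !comp_assoc).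
Defined.

Record Functor (C D : Category) := {
  fobj :> C -> D;
  fmap : forall A B : C, A ~> B -> fobj A ~> fobj B;
  fmap_id : forall A : C, fmap (idn A) = idn (fobj A);
  fmap_comp : forall (A B E : C) (g : B ~> E) (f : A ~> B),
    fmap (g ∘ f) = fmap g ∘ fmap f
}.
Arguments fmap {C D} f {A B} _ : rename.

Definition idfunctor (C : Category) : Functor C C := {|
  fobj := fun A : C => A;
  fmap := fun A B f => f;
  fmap_id := fun A => eq_refl;
  fmap_comp := fun A B E g f => eq_refl
|}.

Definition compfunctor (C D E : Category) (G : Functor D E) (F : Functor C D) :
  Functor C E.
Proof.
refine {| fobj := fun A => G (F A); fmap := fun A B f => fmap G (fmap F f) |}.
- abstract (by move=> A; rewrite !fmap_id).
- abstract (by move=> A B K g f; rewrite !fmap_comp).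
Defined.

Record Adjunction (C D : Category) (F : Functor C D) (G : Functor D C) := {
  adj_to : forall (A : C) (B : D), F A ~> B -> A ~> G B;
  adj_from : forall (A : C) (B : D), A ~> G B -> F A ~> B;
  adj_toK : forall (A : C) (B : D) (f : F A ~> B), adj_from (adj_to f) = f;
  adj_fromK : forall (A : C) (B : D) (g : A ~> G B), adj_to (adj_from g) = g;
  adj_natl : forall (A A' : C) (B : D) (a : A' ~> A) (f : F A ~> B),
    adj_to (f ∘ fmap F a) = adj_to f ∘ a;
  adj_natr : forall (A : C) (B B' : D) (b : B ~> B') (f : F A ~> B),
    adj_to (b ∘ f) = fmap G b ∘ adj_to f
}.

Record FiniteProducts (C : Category) := {
  terminal : C;
  to_terminal : forall A : C, A ~> terminal;
  to_terminal_unique : forall (A : C) (f : A ~> terminal), f = to_terminal A;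
  product : C -> C -> C;
  proj1 : forall A B : C, product A B ~> A;
  proj2 : forall A B : C, product A B ~> B;
  pairing : forall A B D : C, D ~> A -> D ~> B -> D ~> product A B;
  proj1_pairing : forall (A B D : C) (f : D ~> A) (g : D ~> B),
    proj1 A B ∘ pairing f g = f;
  proj2_pairing : forall (A B D : C) (f : D ~> A) (g : D ~> B),
    proj2 A B ∘ pairing f g = g;
  pairing_unique : forall (A B D : C) (f : D ~> A) (g : D ~> B)
      (h : D ~> product A B),
    proj1 A B ∘ h = f -> proj2 A B ∘ h = g -> h = pairing f g
}.

Record FiniteCoproducts (C : Category) := {
  initial : C;
  from_initial : forall A : C, initial ~> A;
  from_initial_unique :
    forall (A : C) (f : initial ~> A), f = from_initial A;
  coproduct : C -> C -> C;
  inj1 : forall A B : C, A ~> coproduct A B;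
  inj2 : forall A B : C, B ~> coproduct A B;
  copairing : forall A B D : C, A ~> D -> B ~> D -> coproduct A B ~> D;
  copairing_inj1 : forall (A B D : C) (f : A ~> D) (g : B ~> D),
    copairing f g ∘ inj1 A B = f;
  copairing_inj2 : forall (A B D : C) (f : A ~> D) (g : B ~> D),
    copairing f g ∘ inj2 A B = g;
  copairing_unique : forall (A B D : C) (f : A ~> D) (g : B ~> D)
      (h : coproduct A B ~> D),
    h ∘ inj1 A B = f -> h ∘ inj2 A B = g -> h = copairing f g
}.

Section FiniteProductTheory.
Variables (C : Category) (P : FiniteProducts C).

Lemma pairing_ext (A B D : C) (h k : D ~> product P A B) :
  proj1 P A B ∘ h = proj1 P A B ∘ k -> proj2 P A B ∘ h = proj2 P A B ∘ k ->
  h = k.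
Proof.
move=> h1 h2; rewrite (pairing_unique h1 h2).
by symmetry; apply: pairing_unique.
Qed.

Definition product_map (A A' B B' : C) (f : A ~> A') (g : B ~> B') :
  product P A B ~> product P A' B' :=
  pairing P (f ∘ proj1 P A B) (g ∘ proj2 P A B).

Lemma product_map_id (A B : C) :
  product_map (idn A) (idn B) = idn (product P A B).
Proof.
by apply: pairing_ext; rewrite ?proj1_pairing ?proj2_pairing comp_idl comp_idr.
Qed.

Lemma product_map_comp (A A' A'' B B' B'' : C) (f' : A' ~> A'') (f : A ~> A')
    (g' : B' ~> B'') (g : B ~> B') :
  product_map (f' ∘ f) (g' ∘ g) = product_map f' g' ∘ product_map f g.
Proof.
apply: pairing_ext.
- by rewrite comp_assoc !proj1_pairing -!comp_assoc proj1_pairing.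
- by rewrite comp_assoc !proj2_pairing -!comp_assoc proj2_pairing.
Qed.
End FiniteProductTheory.

Record MonoidalCategory := {
  mcat :> Category;
  tensor : Functor (prodcat mcat mcat) mcat;
  munit : mcat;
  tens_ob := fun A B : mcat => tensor (A, B);
  tens_hom := fun (A A' B B' : mcat) (f : A ~> A') (g : B ~> B') =>
    (@fmap _ _ tensor (A, B) (A', B') (f, g) : tens_ob A B ~> tens_ob A' B');
  alpha : forall A B C : mcat,
    Iso (tens_ob A (tens_ob B C)) (tens_ob (tens_ob A B) C);
  lambda : forall A : mcat, Iso A (tens_ob munit A);
  rho : forall A : mcat, Iso (tens_ob A munit) A;
  alpha_nat : forall (A A' B B' C C' : mcat)
      (f : A ~> A') (g : B ~> B') (h : C ~> C'),
    alpha A' B' C' ∘ tens_hom f (tens_hom g h)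
    = tens_hom (tens_hom f g) h ∘ alpha A B C;
  lambda_nat : forall (A A' : mcat) (f : A ~> A'),
    lambda A' ∘ f = tens_hom (idn munit) f ∘ lambda A;
  rho_nat : forall (A A' : mcat) (f : A ~> A'),
    rho A' ∘ tens_hom f (idn munit) = f ∘ rho A;
  pentagon : forall A B C D : mcat,
    alpha (tens_ob A B) C D ∘ alpha A B (tens_ob C D)
    = tens_hom (alpha A B C) (idn D) ∘ alpha A (tens_ob B C) D
      ∘ tens_hom (idn A) (alpha B C D);
  triangle : forall A B : mcat,
    tens_hom (rho A) (idn B) ∘ alpha A munit B ∘ tens_hom (idn A) (lambda B)
    = idn (tens_ob A B)
}.
Arguments tens_ob {m} A B.
Arguments tens_hom {m A A' B B'} f g.
Arguments munit m : clear implicits.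

Notation "A ⊗ B" := (tens_ob A B) : cat_scope.
Notation "f ⊠ g" := (tens_hom f g) : cat_scope.

Section MonoidalTheory.
Variable M : MonoidalCategory.

Lemma tens_id (A B : M) : idn A ⊠ idn B = idn (A ⊗ B).
Proof. exact: (fmap_id (tensor M) (A, B)). Qed.

Lemma tens_comp (A A' A'' B B' B'' : M) (f' : A' ~> A'') (f : A ~> A')
    (g' : B' ~> B'') (g : B ~> B') :
  (f' ∘ f) ⊠ (g' ∘ g) = (f' ⊠ g') ∘ (f ⊠ g).
Proof.
exact: (@fmap_comp _ _ (tensor M) (A, B) (A', B') (A'', B'') (f', g') (f, g)).
Qed.

Lemma tens_compl (A B D E : M) (g : B ~> D) (f : A ~> B) :
  (g ∘ f) ⊠ idn E = (g ⊠ idn E) ∘ (f ⊠ idn E).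
Proof. by rewrite -tens_comp comp_idl. Qed.

Lemma alpha_natl (A A' B D : M) (f : A ~> A') :
  alpha A' B D ∘ (f ⊠ idn (B ⊗ D)) = ((f ⊠ idn B) ⊠ idn D) ∘ alpha A B D.
Proof. by rewrite -tens_id alpha_nat. Qed.

Lemma alpha_natlA (A A' B D E : M) (f : A ~> A') (h : (A' ⊗ B) ⊗ D ~> E) :
  h ∘ alpha A' B D ∘ (f ⊠ idn (B ⊗ D))
  = h ∘ ((f ⊠ idn B) ⊠ idn D) ∘ alpha A B D.
Proof. by rewrite -comp_assoc alpha_natl comp_assoc. Qed.

Definition tens_left (A : M) : Functor M M.
Proof.
refine {| fobj := fun B => A ⊗ B; fmap := fun B C f => idn A ⊠ f |}.
- abstract (by move=> B; rewrite tens_id).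
- abstract (by move=> B C D g f; rewrite -tens_comp comp_idl).
Defined.
End MonoidalTheory.

Record LeftClosed (M : MonoidalCategory) := {
  ihom : M -> Functor M M;
  ihom_adj : forall A : M, Adjunction (tens_left A) (ihom A)
}.

Definition iso_id (C : Category) (A : C) : Iso A A := {|
  fwd := idn A; bwd := idn A;
  fwd_bwd := comp_idl (idn A); bwd_fwd := comp_idl (idn A)
|}.

Definition iso_inv (C : Category) (A B : C) (i : Iso A B) : Iso B A := {|
  fwd := bwd i; bwd := i; fwd_bwd := bwd_fwd i; bwd_fwd := fwd_bwd i
|}.

Definition iso_comp (C : Category) (A B D : C) (j : Iso B D) (i : Iso A B) :
  Iso A D.
Proof.
refine {| fwd := j ∘ i; bwd := bwd i ∘ bwd j |}.
- abstract (by rewrite comp_assoc -(comp_assoc j) fwd_bwd comp_idr fwd_bwd).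
- abstract (by rewrite comp_assoc -(comp_assoc (bwd i)) bwd_fwd comp_idr bwd_fwd).
Defined.

Definition iso_fmap (C D : Category) (F : Functor C D) (A B : C) (i : Iso A B) :
  Iso (F A) (F B).
Proof.
refine {| fwd := fmap F i; bwd := fmap F (bwd i) |}.
- abstract (by rewrite -fmap_comp fwd_bwd fmap_id).
- abstract (by rewrite -fmap_comp bwd_fwd fmap_id).
Defined.

Definition iso_pair (C D : Category) (P Q : prodcat C D)
    (i : Iso P.1 Q.1) (j : Iso P.2 Q.2) : Iso P Q.
Proof.
refine (@Build_Iso (prodcat C D) P Q (i : _ ~> _, j : _ ~> _) (bwd i, bwd j) _ _).
- abstract (by rewrite /= !fwd_bwd).
- abstract (by rewrite /= !bwd_fwd).
Defined.

Definition iso_tens (M : MonoidalCategory) (A A' B B' : M)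
    (i : Iso A A') (j : Iso B B') : Iso (A ⊗ B) (A' ⊗ B').
Proof.
refine {| fwd := i ⊠ j; bwd := bwd i ⊠ bwd j |}.
- abstract (by rewrite -tens_comp !fwd_bwd tens_id).
- abstract (by rewrite -tens_comp !bwd_fwd tens_id).
Defined.

Lemma iso_square (C : Category) (U V W S Z : C) (q : Iso U V) (p : Iso V W)
    (a : W ~> Z) (t : Iso U S) (r : Iso S Z) :
  a ∘ p ∘ q = r ∘ t -> bwd t ∘ bwd r ∘ a = bwd q ∘ bwd p.
Proof.
move=> e; rewrite -[RHS]comp_idl -(bwd_fwd (iso_comp r t)) /= -e.
rewrite -!comp_assoc (comp_assoc q) fwd_bwd comp_idl fwd_bwd comp_idr.
by rewrite comp_assoc.
Qed.

Lemma iso_triangle (C : Category) (U V W : C) (q : Iso U V) (p : Iso V W)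
    (a : W ~> U) : a ∘ p ∘ q = idn U -> bwd q ∘ bwd p = a.
Proof.
move=> e; rewrite -[bwd q]comp_idl -e -!comp_assoc (comp_assoc q) fwd_bwd.
by rewrite comp_idl fwd_bwd comp_idr.
Qed.

Section Cocartesian.
Variables (C : Category) (K : FiniteCoproducts C).

Lemma copairing_ext (A B D : C) (h k : coproduct K A B ~> D) :
  h ∘ inj1 K A B = k ∘ inj1 K A B -> h ∘ inj2 K A B = k ∘ inj2 K A B -> h = k.
Proof.
move=> h1 h2; rewrite (copairing_unique h1 h2).
by symmetry; apply: copairing_unique.
Qed.

Lemma from_initial_ext (A : C) (f g : initial K ~> A) : f = g.
Proof. by rewrite (from_initial_unique f) (from_initial_unique g). Qed.

Lemma comp_copairing (A B D E : C) (h : D ~> E) (f : A ~> D) (g : B ~> D) :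
  h ∘ copairing K f g = copairing K (h ∘ f) (h ∘ g).
Proof.
by apply: copairing_unique; rewrite -comp_assoc ?copairing_inj1 ?copairing_inj2.
Qed.

Lemma copairing_inj1A (A B D E : C) (h : D ~> E) (f : A ~> D) (g : B ~> D) :
  h ∘ copairing K f g ∘ inj1 K A B = h ∘ f.
Proof. by rewrite -comp_assoc copairing_inj1. Qed.

Lemma copairing_inj2A (A B D E : C) (h : D ~> E) (f : A ~> D) (g : B ~> D) :
  h ∘ copairing K f g ∘ inj2 K A B = h ∘ g.
Proof. by rewrite -comp_assoc copairing_inj2. Qed.

Definition coproduct_map (A A' B B' : C) (f : A ~> A') (g : B ~> B') :
  coproduct K A B ~> coproduct K A' B' :=
  copairing K (inj1 K A' B' ∘ f) (inj2 K A' B' ∘ g).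

Let simplE := (copairing_inj1, copairing_inj2, copairing_inj1A,
  copairing_inj2A, comp_assoc, comp_idl, comp_idr).

Ltac coprod :=
  rewrite /coproduct_map ?simplE;
  first [ reflexivity
        | solve [apply: from_initial_ext]
        | apply: copairing_ext; coprod ].

Definition coproduct_functor : Functor (prodcat C C) C.
Proof.
refine (@Build_Functor (prodcat C C) C
  (fun P => coproduct K P.1 P.2)
  (fun P Q f => coproduct_map f.1 f.2) _ _).
- abstract (by move=> [A B] /=; coprod).
- abstract (by move=> [A A'] [B B'] [D D'] [g g'] [f f'] /=; coprod).
Defined.

Definition coproduct_assoc (A B D : C) :
  Iso (coproduct K A (coproduct K B D)) (coproduct K (coproduct K A B) D).
Proof.
refine {|
  fwd := copairing K (inj1 K _ _ ∘ inj1 K A B)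
           (copairing K (inj1 K _ _ ∘ inj2 K A B) (inj2 K _ D));
  bwd := copairing K (copairing K (inj1 K A _) (inj2 K _ _ ∘ inj1 K B D))
           (inj2 K _ _ ∘ inj2 K B D) |}; abstract coprod.
Defined.

Definition coproduct_unitl (A : C) : Iso A (coproduct K (initial K) A).
Proof.
refine {| fwd := inj2 K (initial K) A;
          bwd := copairing K (from_initial K A) (idn A) |}; abstract coprod.
Defined.

Definition coproduct_unitr (A : C) : Iso (coproduct K A (initial K)) A.
Proof.
refine {| fwd := copairing K (idn A) (from_initial K A);
          bwd := inj1 K A (initial K) |}; abstract coprod.
Defined.

Definition cocartesian : MonoidalCategory.
Proof.
refine (@Build_MonoidalCategory C coproduct_functor (initial K)
  coproduct_assoc coproduct_unitl coproduct_unitr _ _ _ _ _).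
- abstract (by move=> A A' B B' D D' f g h /=; coprod).
- abstract (by move=> A A' f /=; coprod).
- abstract (by move=> A A' f /=; coprod).
- abstract (by move=> A B D E /=; coprod).
- abstract (by move=> A B /=; coprod).
Defined.
End Cocartesian.

Record StrongMonoidalFunctor (M N : MonoidalCategory) := {
  smf :> Functor M N;
  phi : forall A B : M, Iso (smf A ⊗ smf B) (smf (A ⊗ B));
  phi0 : Iso (munit N) (smf (munit M));
  phi_nat : forall (A A' B B' : M) (f : A ~> A') (g : B ~> B'),
    phi A' B' ∘ (fmap smf f ⊠ fmap smf g) = fmap smf (f ⊠ g) ∘ phi A B;
  phi_alpha : forall A B C : M,
    fmap smf (alpha A B C) ∘ phi A (B ⊗ C) ∘ (idn (smf A) ⊠ phi B C)
    = phi (A ⊗ B) C ∘ (phi A B ⊠ idn (smf C))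
      ∘ alpha (smf A) (smf B) (smf C);
  phi_lambda : forall A : M,
    phi (munit M) A ∘ (phi0 ⊠ idn (smf A)) ∘ lambda (smf A)
    = fmap smf (lambda A);
  phi_rho : forall A : M,
    fmap smf (rho A) ∘ phi A (munit M) ∘ (idn (smf A) ⊠ phi0)
    = rho (smf A)
}.
Arguments phi {M N} s A B.
Arguments phi0 {M N} s.

Record MonoidalNatTrans (M N : MonoidalCategory)
    (F G : StrongMonoidalFunctor M N) := {
  mnt :> forall A : M, F A ~> G A;
  mnt_nat : forall (A B : M) (f : A ~> B), mnt B ∘ fmap F f = fmap G f ∘ mnt A;
  mnt_phi : forall A B : M, mnt (A ⊗ B) ∘ phi F A B = phi G A B ∘ (mnt A ⊠ mnt B);
  mnt_phi0 : mnt (munit M) ∘ phi0 F = phi0 G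
}.

Lemma mnt_ext (M N : MonoidalCategory) (F G : StrongMonoidalFunctor M N)
    (s t : MonoidalNatTrans F G) : (forall A, s A = t A) -> s = t.
Proof.
case: s => s s1 s2 s3; case: t => t t1 t2 t3 /= st.
have {}st : s = t by apply: functional_extensionality_dep.
by case: _ / st in t1 t2 t3 *; f_equal; apply: proof_irrelevance.
Qed.

Definition mnt_id (M N : MonoidalCategory) (F : StrongMonoidalFunctor M N) :
  MonoidalNatTrans F F.
Proof.
refine (@Build_MonoidalNatTrans M N F F (fun A => idn (F A)) _ _ _).
- abstract (by move=> A B f; rewrite comp_idl comp_idr).
- abstract (by move=> A B; rewrite tens_id comp_idl comp_idr).
- abstract (by rewrite comp_idl).
Defined.

Definition mnt_comp (M N : MonoidalCategory) (F G H : StrongMonoidalFunctor M N)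
    (t : MonoidalNatTrans G H) (s : MonoidalNatTrans F G) : MonoidalNatTrans F H.
Proof.
refine (@Build_MonoidalNatTrans M N F H (fun A => t A ∘ s A) _ _ _).
- abstract (by move=> A B f;
  rewrite -comp_assoc mnt_nat comp_assoc mnt_nat -comp_assoc).
- abstract (move=> A B; rewrite -comp_assoc mnt_phi comp_assoc mnt_phi;
   by rewrite -comp_assoc -tens_comp).
- abstract (by rewrite -comp_assoc !mnt_phi0).
Defined.

Definition smfcat (M N : MonoidalCategory) : Category.
Proof.
refine {|
  Ob := StrongMonoidalFunctor M N;
  Hom := @MonoidalNatTrans M N;
  idn := @mnt_id M N;
  comp := @mnt_comp M N |}.
- abstract (by move=> F G s; apply: mnt_ext => A /=; rewrite comp_idl).
- abstract (by move=> F G s; apply: mnt_ext => A /=; rewrite comp_idr).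
- abstract (by move=> F G H K u t s; apply: mnt_ext => A /=;
  rewrite comp_assoc).
Defined.

Definition smf_id (M : MonoidalCategory) : StrongMonoidalFunctor M M.
Proof.
refine (@Build_StrongMonoidalFunctor M M (idfunctor M)
  (fun A B => iso_id (A ⊗ B)) (iso_id (munit M)) _ _ _ _); rewrite /=.
- abstract (by move=> A A' B B' f g; rewrite comp_idl comp_idr).
- abstract (by move=> A B C; rewrite !tens_id !comp_idr comp_idl).
- abstract (by move=> A; rewrite tens_id !comp_idl).
- abstract (by move=> A; rewrite tens_id !comp_idr).
Defined.

Section SmfComp.
Variables (M N P : MonoidalCategory).
Variables (G : StrongMonoidalFunctor N P) (F : StrongMonoidalFunctor M N).

Lemma tens_fmapl (A B D : N) (E : P) (g : A ~> B) (f : E ~> G A) :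
  (fmap G g ∘ f) ⊠ idn (G D) = (fmap G g ⊠ fmap G (idn D)) ∘ (f ⊠ idn (G D)).
Proof. by rewrite -tens_comp fmap_id comp_idl. Qed.

Lemma tens_fmapr (A B D : N) (E : P) (g : A ~> B) (f : E ~> G A) :
  idn (G D) ⊠ (fmap G g ∘ f) = (fmap G (idn D) ⊠ fmap G g) ∘ (idn (G D) ⊠ f).
Proof. by rewrite -tens_comp fmap_id comp_idl. Qed.

Lemma smf_comp_nat (A A' B B' : M) (f : A ~> A') (g : B ~> B') :
  fmap G (phi F A' B') ∘ phi G (F A') (F B')
    ∘ (fmap G (fmap F f) ⊠ fmap G (fmap F g))
  = fmap G (fmap F (f ⊠ g)) ∘ (fmap G (phi F A B) ∘ phi G (F A) (F B)).
Proof.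
rewrite -comp_assoc phi_nat !comp_assoc; congr (_ ∘ _).
by rewrite -!fmap_comp phi_nat.
Qed.

Lemma smf_comp_alpha (A B C : M) :
  fmap G (fmap F (alpha A B C))
    ∘ (fmap G (phi F A (B ⊗ C)) ∘ phi G (F A) (F (B ⊗ C)))
    ∘ (idn (G (F A)) ⊠ (fmap G (phi F B C) ∘ phi G (F B) (F C)))
  = fmap G (phi F (A ⊗ B) C) ∘ phi G (F (A ⊗ B)) (F C)
    ∘ ((fmap G (phi F A B) ∘ phi G (F A) (F B)) ⊠ idn (G (F C)))
    ∘ alpha (G (F A)) (G (F B)) (G (F C)).
Proof.
rewrite tens_fmapl tens_fmapr.
rewrite !comp_assoc -(comp_assoc (_ ∘ fmap G _) (phi G _ _)) phi_nat.
rewrite -(comp_assoc (fmap G (phi F (A ⊗ B) C)) (phi G _ _)) phi_nat.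
rewrite !comp_assoc -!fmap_comp phi_alpha fmap_comp -!comp_assoc.
by congr (_ ∘ _); rewrite !comp_assoc phi_alpha.
Qed.

Lemma smf_comp_lambda (A : M) :
  fmap G (phi F (munit M) A) ∘ phi G (F (munit M)) (F A)
    ∘ ((fmap G (phi0 F) ∘ phi0 G) ⊠ idn (G (F A))) ∘ lambda (G (F A))
  = fmap G (fmap F (lambda A)).
Proof.
rewrite tens_fmapl !comp_assoc -(comp_assoc _ (phi G _ _)) phi_nat.
rewrite -[fmap F (lambda A)]phi_lambda !fmap_comp.
by rewrite -[fmap G (lambda (F A))]phi_lambda !comp_assoc.
Qed.

Lemma smf_comp_rho (A : M) :
  fmap G (fmap F (rho A))
    ∘ (fmap G (phi F A (munit M)) ∘ phi G (F A) (F (munit M)))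
    ∘ (idn (G (F A)) ⊠ (fmap G (phi0 F) ∘ phi0 G))
  = rho (G (F A)).
Proof.
rewrite tens_fmapr !comp_assoc -(comp_assoc _ (phi G _ _)) phi_nat.
by rewrite !comp_assoc -!fmap_comp phi_rho phi_rho.
Qed.

Definition smf_comp : StrongMonoidalFunctor M P :=
  @Build_StrongMonoidalFunctor M P (compfunctor G F)
    (fun A B => iso_comp (iso_fmap G (phi F A B)) (phi G (F A) (F B)))
    (iso_comp (iso_fmap G (phi0 F)) (phi0 G))
    smf_comp_nat smf_comp_alpha smf_comp_lambda smf_comp_rho.
End SmfComp.

Section Endofunctors.
Variable C : MonoidalCategory.
Let E := smfcat C C.

Definition mnt_hcomp (F F' G G' : StrongMonoidalFunctor C C)
    (s : MonoidalNatTrans F F') (t : MonoidalNatTrans G G') :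
  MonoidalNatTrans (smf_comp G F) (smf_comp G' F').
Proof.
refine (@Build_MonoidalNatTrans C C (smf_comp G F) (smf_comp G' F')
  (fun A => t (F' A) ∘ fmap G (s A)) _ _ _) => /=.
- abstract (move=> A B f;
   by rewrite -comp_assoc -fmap_comp (mnt_nat s) fmap_comp !comp_assoc mnt_nat).
- abstract (move=> A B; rewrite tens_comp !comp_assoc;
   rewrite -(comp_assoc (t _) (fmap G _)) -fmap_comp mnt_phi fmap_comp;
   rewrite -!comp_assoc -phi_nat !comp_assoc mnt_nat;
   by rewrite -!comp_assoc; congr (_ ∘ _); rewrite !comp_assoc mnt_phi).
- abstract (rewrite !comp_assoc -(comp_assoc (t _)) -fmap_comp mnt_phi0 mnt_nat;
   by rewrite -comp_assoc mnt_phi0).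
Defined.

Definition endo_tensor : Functor (prodcat E E) E.
Proof.
refine (@Build_Functor (prodcat E E) E
  (fun P : prodcat E E => smf_comp P.2 P.1 : E)
  (fun (P Q : prodcat E E) (f : P ~> Q) => mnt_hcomp f.1 f.2) _ _).
- abstract (by move=> [F G]; apply: mnt_ext => A /=; rewrite fmap_id comp_idl).
- abstract (move=> [F F'] [G G'] [H H'] [t t'] [s s']; apply: mnt_ext => A /=;
   rewrite fmap_comp -!comp_assoc; congr (_ ∘ _);
   by rewrite !comp_assoc mnt_nat).
Defined.

Definition mnt_inv (F G : StrongMonoidalFunctor C C) (s : MonoidalNatTrans F G)
    (r : forall A, G A ~> F A) (sr : forall A, s A ∘ r A = idn (G A))
    (rs : forall A, r A ∘ s A = idn (F A)) : MonoidalNatTrans G F.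
Proof.
refine (@Build_MonoidalNatTrans C C G F r _ _ _).
- abstract (move=> A B f;
   rewrite -[fmap G f]comp_idr -(sr A) (comp_assoc (fmap G f)) -mnt_nat;
   by rewrite !comp_assoc rs comp_idl).
- abstract (move=> A B;
   rewrite -[phi G A B : _ ~> _]comp_idr -tens_id -(sr A) -(sr B) tens_comp;
   by rewrite (comp_assoc (phi G A B)) -mnt_phi !comp_assoc rs comp_idl).
- abstract (by rewrite -(mnt_phi0 s) comp_assoc rs comp_idl).
Defined.

Definition smf_iso (F G : StrongMonoidalFunctor C C)
    (i : forall A, Iso (F A) (G A))
    (inat : forall (A B : C) (f : A ~> B), i B ∘ fmap F f = fmap G f ∘ i A)
    (iphi : forall A B : C, i (A ⊗ B) ∘ phi F A B = phi G A B ∘ (i A ⊠ i B))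
    (iphi0 : i (munit C) ∘ phi0 F = phi0 G) : @Iso E F G.
Proof.
pose s := @Build_MonoidalNatTrans C C F G (fun A => i A) inat iphi iphi0.
refine (@Build_Iso E F G s (@mnt_inv F G s (fun A => bwd (i A))
  (fun A => fwd_bwd (i A)) (fun A => bwd_fwd (i A))) _ _).
- abstract (by apply: mnt_ext => A /=; rewrite fwd_bwd).
- abstract (by apply: mnt_ext => A /=; rewrite bwd_fwd).
Defined.

(** Functor composition is associative and unital on the nose on the level of
    object and morphism maps, so the strict structure isomorphisms have
    identity components. *)
Definition endo_alpha (F G H : E) :
  @Iso E (smf_comp (smf_comp H G) F) (smf_comp H (smf_comp G F)).
Proof.
refine (@smf_iso (smf_comp (smf_comp H G) F) (smf_comp H (smf_comp G F))
  (fun A => iso_id (H (G (F A)))) _ _ _) => /=.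
- abstract (by move=> A B f; rewrite comp_idl comp_idr).
- abstract (by move=> A B;
  rewrite tens_id comp_idl comp_idr fmap_comp comp_assoc).
- abstract (by rewrite comp_idl fmap_comp comp_assoc).
Defined.

Definition endo_lambda (F : E) : @Iso E F (smf_comp F (smf_id C)).
Proof.
refine (@smf_iso F (smf_comp F (smf_id C)) (fun A => iso_id (F A)) _ _ _) => /=.
- abstract (by move=> A B f; rewrite comp_idl comp_idr).
- abstract (by move=> A B; rewrite tens_id fmap_id !comp_idl comp_idr).
- abstract (by rewrite fmap_id !comp_idl).
Defined.

Definition endo_rho (F : E) : @Iso E (smf_comp (smf_id C) F) F.
Proof.
refine (@smf_iso (smf_comp (smf_id C) F) F (fun A => iso_id (F A)) _ _ _) => /=.
- abstract (by move=> A B f; rewrite comp_idl comp_idr).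
- abstract (by move=> A B; rewrite tens_id comp_idl !comp_idr).
- abstract (by rewrite comp_idl comp_idr).
Defined.

Definition endo : MonoidalCategory.
Proof.
refine (@Build_MonoidalCategory E endo_tensor (smf_id C : E)
  endo_alpha endo_lambda endo_rho _ _ _ _ _).
- abstract (move=> F F' G G' H H' f g h; apply: mnt_ext => A /=;
   by rewrite comp_idl comp_idr fmap_comp comp_assoc).
- abstract (by move=> F F' f; apply: mnt_ext => A /=;
  rewrite fmap_id comp_idl !comp_idr).
- abstract (by move=> F F' f; apply: mnt_ext => A /=;
  rewrite !comp_idl comp_idr).
- abstract (move=> F G H K; apply: mnt_ext => A /=;
   by rewrite !fmap_id !comp_idl).
- abstract (by move=> F G; apply: mnt_ext => A /=; rewrite !fmap_id !comp_idl).
Defined.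

Lemma endo_alpha_at (F G H U V W Z : StrongMonoidalFunctor C C)
    (p : MonoidalNatTrans (smf_comp G F) U)
    (q : MonoidalNatTrans (smf_comp H G) V)
    (r : MonoidalNatTrans (smf_comp H U) W)
    (s : MonoidalNatTrans (smf_comp V F) Z)
    (a : MonoidalNatTrans Z W) (A : C) :
  mnt_comp (mnt_comp a s) (mnt_hcomp (mnt_id F) q)
  = mnt_comp (mnt_comp r (mnt_hcomp p (mnt_id H))) (fwd (endo_alpha F G H)) ->
  mnt a A ∘ mnt s A ∘ mnt q (F A) = mnt r A ∘ fmap H (mnt p A).
Proof.
move=> e; move: (f_equal (fun t => mnt t A) e) => /=.
by rewrite !fmap_id comp_idl !comp_idr.
Qed.
End Endofunctors.

(** Keeps conversion between the operations of [endo] and their definitions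
    from unfolding the definitions any further. *)
Strategy 1000 [smf_comp smf_id mnt_comp mnt_id mnt_hcomp smf_iso
  endo_alpha endo_lambda endo_rho].

Definition StrongAction (X C : MonoidalCategory) : Type :=
  StrongMonoidalFunctor X (endo C).

Section Action.
Variables (X C : MonoidalCategory) (Gam : StrongAction X C).

(** [act x] is the functor (-)^x and [actm f] the transformation (-)^f. *)
Definition act (x : X) : StrongMonoidalFunctor C C := Gam x.

Definition actm (x y : X) (f : x ~> y) : MonoidalNatTrans (act x) (act y) :=
  fmap Gam f.

Definition mnt_iso_at (F G : endo C) (i : Iso F G) (A : C) :
  Iso ((F : StrongMonoidalFunctor C C) A) ((G : StrongMonoidalFunctor C C) A).
Proof.
refine {| fwd := (fwd i : MonoidalNatTrans F G) A;
          bwd := (bwd i : MonoidalNatTrans G F) A |}.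
- abstract (by have /(f_equal (fun t : MonoidalNatTrans G G => t A)) := fwd_bwd i).
- abstract (by have /(f_equal (fun t : MonoidalNatTrans F F => t A)) := bwd_fwd i).
Defined.

(** [phi Gam] and [phi0 Gam] are the lax structure isomorphisms of [Gam]; [psi]
    and [psi0] are the components of their inverses. *)
Definition psi (x y : X) (A : C) : Iso (act (x ⊗ y) A) (act y (act x A)) :=
  iso_inv (mnt_iso_at (phi Gam x y) A).

Definition psi0 (A : C) : Iso (act (munit X) A) A :=
  iso_inv (mnt_iso_at (phi0 Gam) A).

Definition actmm (x y : X) (A B : C) (f : x ~> y) (b : A ~> B) :
  act x A ~> act y B := fmap (act y) b ∘ actm f A.

Lemma actm_id (x : X) (A : C) : actm (idn x) A = idn (act x A).
Proof. by rewrite /actm fmap_id. Qed.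

Lemma actm_comp (x y z : X) (g : y ~> z) (f : x ~> y) (A : C) :
  actm (g ∘ f) A = actm g A ∘ actm f A.
Proof. by rewrite /actm fmap_comp. Qed.

Lemma psi_nat (x y : X) (A B : C) (f : A ~> B) :
  psi x y B ∘ fmap (act (x ⊗ y)) f = fmap (act y) (fmap (act x) f) ∘ psi x y A.
Proof. exact: (mnt_nat (bwd (phi Gam x y) : MonoidalNatTrans _ _) f). Qed.

Lemma psi_phi (x y : X) (A B : C) :
  psi x y (A ⊗ B) ∘ phi (act (x ⊗ y)) A B
  = fmap (act y) (phi (act x) A B) ∘ phi (act y) (act x A) (act x B)
    ∘ (psi x y A ⊠ psi x y B).
Proof. exact: (mnt_phi (bwd (phi Gam x y) : MonoidalNatTrans _ _) A B). Qed.

Lemma psi0_nat (A B : C) (f : A ~> B) :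
  psi0 B ∘ fmap (act (munit X)) f = f ∘ psi0 A.
Proof. exact: (mnt_nat (bwd (phi0 Gam) : MonoidalNatTrans _ _) f). Qed.

Lemma psi_actm (x x' y y' : X) (f : x ~> x') (g : y ~> y') (A : C) :
  psi x' y' A ∘ actm (f ⊠ g) A
  = actm g (act x' A) ∘ fmap (act y) (actm f A) ∘ psi x y A.
Proof.
have /(f_equal (fun t : MonoidalNatTrans _ _ => t A)) /= e := phi_nat Gam f g.
rewrite -[actm (f ⊠ g) A]comp_idr -(fwd_bwd (mnt_iso_at (phi Gam x y) A)).
rewrite (comp_assoc (actm _ _)) -[actm _ _ ∘ _]e !comp_assoc.
by rewrite (bwd_fwd (mnt_iso_at (phi Gam x' y') A)) comp_idl.
Qed.

Lemma psi_alpha (x y z : X) (A : C) :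
  fmap (act z) (psi x y A) ∘ psi (x ⊗ y) z A ∘ actm (alpha x y z) A
  = psi y z (act x A) ∘ psi x (y ⊗ z) A.
Proof.
apply: (@iso_square C _ _ _ _ _ (mnt_iso_at (phi Gam y z) (act x A))
  (mnt_iso_at (phi Gam x (y ⊗ z)) A) (actm (alpha x y z) A)
  (iso_fmap (act z) (mnt_iso_at (phi Gam x y) A))
  (mnt_iso_at (phi Gam (x ⊗ y) z) A)).
exact: (@endo_alpha_at C (act x) (act y) (act z) (act (x ⊗ y)) (act (y ⊗ z))
  (act ((x ⊗ y) ⊗ z)) (act (x ⊗ (y ⊗ z))) (fwd (phi Gam x y))
  (fwd (phi Gam y z)) (fwd (phi Gam (x ⊗ y) z)) (fwd (phi Gam x (y ⊗ z)))
  (actm (alpha x y z)) A (phi_alpha Gam x y z)).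
Qed.

Lemma psi_lambda (x : X) (A : C) :
  fmap (act x) (psi0 A) ∘ psi (munit X) x A ∘ actm (lambda x) A = idn (act x A).
Proof.
have /(f_equal (fun t : MonoidalNatTrans _ _ => t A)) /= := phi_lambda Gam x.
rewrite comp_idl comp_idr => e; rewrite /actm -e.
exact: (bwd_fwd (iso_comp (mnt_iso_at (phi Gam (munit X) x) A)
  (iso_fmap (act x) (mnt_iso_at (phi0 Gam) A)))).
Qed.

Lemma psi_rho (x : X) (A : C) :
  psi0 (act x A) ∘ psi x (munit X) A = actm (rho x) A.
Proof.
have /(f_equal (fun t : MonoidalNatTrans _ _ => t A)) /= := phi_rho Gam x.
rewrite comp_idr => e.
pose p := mnt_iso_at (phi Gam x (munit X)) A.
pose q := mnt_iso_at (phi0 Gam) (act x A).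
exact: (@iso_triangle C _ _ _ q p (actm (rho x) A) e).
Qed.

Lemma actmm_id (x : X) (A : C) : actmm (idn x) (idn A) = idn (act x A).
Proof. by rewrite /actmm actm_id fmap_id comp_idl. Qed.

Lemma actmm_comp (x y z : X) (A B D : C) (g : y ~> z) (f : x ~> y)
    (b : B ~> D) (a : A ~> B) :
  actmm (g ∘ f) (b ∘ a) = actmm g b ∘ actmm f a.
Proof.
rewrite /actmm actm_comp fmap_comp -!comp_assoc; congr (_ ∘ _).
by rewrite !comp_assoc mnt_nat.
Qed.

Lemma psi_actmm (x x' y y' : X) (A B : C) (f : x ~> x') (g : y ~> y')
    (a : A ~> B) :
  psi x' y' B ∘ actmm (f ⊠ g) a = actmm g (actmm f a) ∘ psi x y A.
Proof.
rewrite /actmm comp_assoc psi_nat -comp_assoc psi_actm !comp_assoc fmap_comp.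
by rewrite -(comp_assoc _ (actm g _)) mnt_nat !comp_assoc.
Qed.

Lemma phi_actmm (x y : X) (A A' B B' : C) (f : x ~> y) (a : A ~> A')
    (b : B ~> B') :
  phi (act y) A' B' ∘ (actmm f a ⊠ actmm f b)
  = actmm f (a ⊠ b) ∘ phi (act x) A B.
Proof.
by rewrite /actmm tens_comp comp_assoc phi_nat -!comp_assoc mnt_phi.
Qed.

Definition semidirect_tensor :
  Functor (prodcat (prodcat X C) (prodcat X C)) (prodcat X C).
Proof.
refine (@Build_Functor (prodcat (prodcat X C) (prodcat X C)) (prodcat X C)
  (fun P => (P.1.1 ⊗ P.2.1, act P.2.1 P.1.2 ⊗ P.2.2))
  (fun P Q f => (f.1.1 ⊠ f.2.1, actmm f.2.1 f.1.2 ⊠ f.2.2)) _ _).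
- abstract (by move=> P /=; rewrite actmm_id !tens_id).
- abstract (by move=> P Q R g f /=; rewrite actmm_comp !tens_comp).
Defined.

Definition semidirect_alpha (P Q R : prodcat X C) :
  @Iso (prodcat X C)
    (P.1 ⊗ (Q.1 ⊗ R.1), act (Q.1 ⊗ R.1) P.2 ⊗ (act R.1 Q.2 ⊗ R.2))
    ((P.1 ⊗ Q.1) ⊗ R.1, act R.1 (act Q.1 P.2 ⊗ Q.2) ⊗ R.2) :=
  @iso_pair X C (_, _) (_, _)
    (alpha P.1 Q.1 R.1)
    (iso_comp (iso_tens (phi (act R.1) (act Q.1 P.2) Q.2) (iso_id R.2))
    (iso_comp (alpha (act R.1 (act Q.1 P.2)) (act R.1 Q.2) R.2)
      (iso_tens (psi Q.1 R.1 P.2) (iso_id (act R.1 Q.2 ⊗ R.2))))).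

Definition semidirect_lambda (P : prodcat X C) :
  @Iso (prodcat X C) P (munit X ⊗ P.1, act P.1 (munit C) ⊗ P.2) :=
  @iso_pair X C P (_, _)
    (lambda P.1)
    (iso_comp (iso_tens (phi0 (act P.1)) (iso_id P.2)) (lambda P.2)).

Definition semidirect_rho (P : prodcat X C) :
  @Iso (prodcat X C) (P.1 ⊗ munit X, act (munit X) P.2 ⊗ munit C) P :=
  @iso_pair X C (_, _) P
    (rho P.1)
    (iso_comp (rho P.2) (iso_tens (psi0 P.2) (iso_id (munit C)))).

Lemma semidirect_alpha_nat (y y' z z' : X) (A A' B B' D D' : C)
    (g : y ~> y') (h : z ~> z') (a : A ~> A') (b : B ~> B') (d : D ~> D') :
  (phi (act z') (act y' A') B' ⊠ idn D')
    ∘ (alpha _ _ _ ∘ (psi y' z' A' ⊠ idn (act z' B' ⊗ D')))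
    ∘ (actmm (g ⊠ h) a ⊠ (actmm h b ⊠ d))
  = (actmm h (actmm g a ⊠ b) ⊠ d)
    ∘ ((phi (act z) (act y A) B ⊠ idn D)
       ∘ (alpha _ _ _ ∘ (psi y z A ⊠ idn (act z B ⊗ D)))).
Proof.
rewrite -!comp_assoc -tens_comp psi_actmm comp_idl.
rewrite -[actmm h b ⊠ d]comp_idr tens_comp (comp_assoc (alpha _ _ _)) alpha_nat.
rewrite !comp_assoc -!tens_comp phi_actmm comp_idl.
by rewrite comp_idr.
Qed.

Lemma semidirect_lambda_nat (x x' : X) (A A' : C) (f : x ~> x') (a : A ~> A') :
  (phi0 (act x') ⊠ idn A') ∘ lambda A' ∘ a
  = (actmm f (idn (munit C)) ⊠ a) ∘ ((phi0 (act x) ⊠ idn A) ∘ lambda A).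
Proof.
rewrite -comp_assoc lambda_nat !comp_assoc -!tens_comp comp_idr comp_idl comp_idr.
by rewrite /actmm fmap_id comp_idl mnt_phi0.
Qed.

Lemma semidirect_rho_nat (A A' : C) (a : A ~> A') :
  rho A' ∘ (psi0 A' ⊠ idn (munit C))
    ∘ (actmm (idn (munit X)) a ⊠ idn (munit C))
  = a ∘ (rho A ∘ (psi0 A ⊠ idn (munit C))).
Proof.
rewrite -comp_assoc -tens_comp /actmm actm_id comp_idr psi0_nat.
by rewrite tens_comp !comp_assoc rho_nat.
Qed.

Lemma semidirect_pentagon (y z w : X) (A B D E : C) :
  (phi (act w) (act z (act y A ⊗ B)) D ⊠ idn E)
    ∘ (alpha _ _ _ ∘ (psi z w (act y A ⊗ B) ⊠ idn (act w D ⊗ E)))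
    ∘ ((phi (act (z ⊗ w)) (act y A) B ⊠ idn (act w D ⊗ E))
       ∘ (alpha _ _ _
          ∘ (psi y (z ⊗ w) A ⊠ idn (act (z ⊗ w) B ⊗ (act w D ⊗ E)))))
  = (actmm (idn w)
       ((phi (act z) (act y A) B ⊠ idn D)
        ∘ (alpha _ _ _ ∘ (psi y z A ⊠ idn (act z B ⊗ D)))) ⊠ idn E)
    ∘ ((phi (act w) (act (y ⊗ z) A) (act z B ⊗ D) ⊠ idn E)
       ∘ (alpha _ _ _
          ∘ (psi (y ⊗ z) w A ⊠ idn (act w (act z B ⊗ D) ⊗ E))))
    ∘ (actmm (alpha y z w) (idn A)
       ⊠ ((phi (act w) (act z B) D ⊠ idn E)
          ∘ (alpha _ _ _ ∘ (psi z w B ⊠ idn (act w D ⊗ E))))).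
Proof.
set pz := fmap (act w) (phi (act z) (act y A) B).
pose P := (phi (act w) (act z (act y A ⊗ B)) D ⊠ idn E)
  ∘ ((pz ⊠ idn (act w D)) ⊠ idn E)
  ∘ ((phi (act w) (act z (act y A)) (act z B) ⊠ idn (act w D)) ⊠ idn E).
pose Q := (psi z w (act y A) ∘ psi y (z ⊗ w) A)
  ⊠ (psi z w B ⊠ idn (act w D ⊗ E)).
transitivity (P ∘ (alpha _ _ _ ∘ alpha _ _ _ ∘ Q)).
- rewrite -!comp_assoc (comp_assoc (psi z w _ ⊠ _)) -tens_compl psi_phi.
  rewrite !tens_compl !comp_assoc (alpha_natlA pz).
  rewrite (alpha_natlA (phi (act w) (act z (act y A)) (act z B) : _ ~> _)).
  rewrite (alpha_natlA (psi z w (act y A) ⊠ psi z w B)) -/P.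
  clearbody P; rewrite -!comp_assoc; congr (P ∘ _).
  rewrite !comp_assoc -alpha_natl -!comp_assoc; congr (_ ∘ _).
  by rewrite comp_assoc -alpha_nat -comp_assoc -tens_comp comp_idr.
- set R := (_ ⊠ idn E) ∘ (_ ∘ (psi z w B ⊠ _)).
  pose L := fmap (act w) (phi (act z) (act y A) B ⊠ idn D)
    ∘ fmap (act w) (alpha (act z (act y A)) (act z B) D)
    ∘ phi (act w) (act z (act y A)) (act z B ⊗ D).
  transitivity ((L ⊠ idn E) ∘ (alpha _ _ _
    ∘ ((psi z w (act y A) ∘ psi y (z ⊗ w) A) ⊠ R))).
  + have -> : (psi z w (act y A) ∘ psi y (z ⊗ w) A) ⊠ R
        = (idn _ ⊠ (phi (act w) (act z B) D ⊠ idn E))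
          ∘ ((idn _ ⊠ alpha _ _ _) ∘ Q).
      by rewrite /Q -!tens_comp !comp_idl.
    have eL : L ∘ (idn _ ⊠ phi (act w) (act z B) D)
        = phi (act w) (act z (act y A ⊗ B)) D ∘ (pz ⊠ idn (act w D))
          ∘ (phi (act w) (act z (act y A)) (act z B) ⊠ idn (act w D)) ∘ alpha _ _ _.
      rewrite /L -!comp_assoc (comp_assoc (fmap (act w) (alpha _ _ _))).
      by rewrite phi_alpha !comp_assoc -phi_nat fmap_id.
    rewrite [in RHS](comp_assoc (alpha _ _ _)) [in RHS]alpha_nat.
    rewrite -[in RHS]comp_assoc [in RHS](comp_assoc (L ⊠ idn E)).
    rewrite -tens_compl eL !tens_compl -/P.
    clearbody P; rewrite -[in RHS]comp_assoc; congr (P ∘ _).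
    by rewrite pentagon !comp_assoc.
  + rewrite -!comp_assoc -tens_comp comp_idl (comp_assoc (_ ⊠ idn E) (_ ⊠ idn E)).
    rewrite -tens_compl /actmm !actm_id !fmap_id !comp_idr comp_idl.
    have -> : fmap (act w) ((phi (act z) (act y A) B ⊠ idn D)
          ∘ (alpha _ _ _ ∘ (psi y z A ⊠ idn (act z B ⊗ D))))
        ∘ phi (act w) (act (y ⊗ z) A) (act z B ⊗ D)
        = L ∘ (fmap (act w) (psi y z A) ⊠ idn _).
      by rewrite !fmap_comp -!comp_assoc -phi_nat fmap_id /L ?comp_assoc.
    rewrite tens_compl -[in RHS]comp_assoc.
    rewrite [in RHS](comp_assoc ((_ ⊠ _) ⊠ _)) -[in RHS]alpha_natl.
    rewrite -[in RHS]comp_assoc -tens_comp comp_idl.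
    by rewrite -psi_alpha !comp_assoc.
Qed.

Lemma semidirect_triangle (y : X) (A B : C) :
  (actmm (idn y) (rho A ∘ (psi0 A ⊠ idn (munit C))) ⊠ idn B)
    ∘ ((phi (act y) (act (munit X) A) (munit C) ⊠ idn B)
       ∘ (alpha _ _ _ ∘ (psi (munit X) y A ⊠ idn (act y (munit C) ⊗ B))))
    ∘ (actmm (lambda y) (idn A) ⊠ ((phi0 (act y) ⊠ idn B) ∘ lambda B))
  = idn (act y A ⊗ B).
Proof.
rewrite /actmm actm_id comp_idr fmap_id comp_idl fmap_comp -!comp_assoc.
rewrite -tens_comp comp_idl.
set g := (phi0 (act y) ⊠ idn B ∘ lambda B).
rewrite (comp_assoc (_ ⊠ idn B)) -tens_compl.
have -> : fmap (act y) (rho A) ∘ fmap (act y) (psi0 A ⊠ idn (munit C))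
    ∘ phi (act y) (act (munit X) A) (munit C)
    = fmap (act y) (rho A) ∘ phi (act y) A (munit C)
      ∘ (fmap (act y) (psi0 A) ⊠ idn (act y (munit C))).
  by rewrite -!comp_assoc -(fmap_id (act y)) phi_nat.
rewrite tens_compl -comp_assoc (comp_assoc (_ ⊠ idn B) (alpha _ _ _)).
rewrite -alpha_natl -comp_assoc -tens_comp comp_idl.
rewrite (comp_assoc (fmap _ (psi0 A))) psi_lambda.
rewrite /g -(comp_idl (idn (act y A))) tens_comp (comp_assoc (alpha _ _ _)).
rewrite alpha_nat !comp_assoc -tens_compl phi_rho.
exact: triangle.
Qed.

Definition semidirect : MonoidalCategory.
Proof.
refine (@Build_MonoidalCategory (prodcat X C) semidirect_tensor
  (munit X, munit C) semidirect_alpha semidirect_lambda semidirect_rho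
  _ _ _ _ _).
- abstract (move=> P P' Q Q' R R' f g h; congr (_, _) => /=;
  first exact: alpha_nat;
   exact: semidirect_alpha_nat).
- abstract (move=> P P' f; congr (_, _) => /=; first exact: lambda_nat;
   exact: semidirect_lambda_nat).
- abstract (move=> P P' f; congr (_, _) => /=; first exact: rho_nat;
   exact: semidirect_rho_nat).
- abstract (move=> P Q R S; congr (_, _) => /=; first exact: pentagon;
   exact: semidirect_pentagon).
- abstract (move=> P Q; congr (_, _) => /=; first exact: triangle;
   exact: semidirect_triangle).
Defined.
End Action.

(** [R (B, D)] is B ▷ D.  A morphism [b : B' ~> B] of [C] is a morphism from [B]
    to [B'] in [opcat C]. *)
Record ActionHom (X C : MonoidalCategory) (Gam : StrongAction X C)
    (R : Functor (prodcat (opcat C) C) X) := {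
  ah_to : forall (x : X) (B D : C), act Gam x B ~> D -> x ~> R (B, D);
  ah_from : forall (x : X) (B D : C), x ~> R (B, D) -> act Gam x B ~> D;
  ah_toK : forall (x : X) (B D : C) (f : act Gam x B ~> D),
    ah_from (ah_to f) = f;
  ah_fromK : forall (x : X) (B D : C) (g : x ~> R (B, D)),
    ah_to (ah_from g) = g;
  ah_nat_act : forall (x x' : X) (B D : C) (h : x' ~> x) (f : act Gam x B ~> D),
    ah_to (f ∘ actm Gam h B) = ah_to f ∘ h;
  ah_nat_src : forall (x : X) (B B' D : C) (b : B' ~> B) (f : act Gam x B ~> D),
    ah_to (f ∘ fmap (act Gam x) b)
    = @fmap _ _ R (B, D) (B', D) (b, idn D) ∘ ah_to f;
  ah_nat_tgt : forall (x : X) (B D D' : C) (d : D ~> D') (f : act Gam x B ~> D),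
    ah_to (d ∘ f) = @fmap _ _ R (B, D) (B, D') (idn B, d) ∘ ah_to f
}.

(** [⟨x, A⟩, -], sending ⟨z, D⟩ to ⟨[x, z] × (A ▷ D), D⟩. *)
Definition semidirect_ihom (X : MonoidalCategory) (LX : LeftClosed X)
    (PX : FiniteProducts X) (C : Category)
    (R : Functor (prodcat (opcat C) C) X) (x : X) (A : C) :
  Functor (prodcat X C) (prodcat X C).
Proof.
refine (@Build_Functor (prodcat X C) (prodcat X C)
  (fun P => (product PX (ihom LX x P.1) (R (A, P.2)), P.2))
  (fun P Q f =>
     (product_map PX (fmap (ihom LX x) f.1)
        (@fmap _ _ R (A, P.2) (A, Q.2) (idn A, f.2)), f.2)) _ _).
- abstract (move=> P /=; rewrite fmap_id;
   by rewrite (fmap_id R (A, P.2)) product_map_id).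
- abstract (move=> P Q S g f /=; rewrite fmap_comp -product_map_comp;
   rewrite -(@fmap_comp _ _ R (A, P.2) (A, Q.2) (A, S.2)) /=;
   by rewrite comp_idl).
Defined.

(* Main.v *)
(** A morphism [⟨x, A⟩ ⊗ ⟨y, B⟩ ~> ⟨z, D⟩] is a pair of [x ⊗ y ~> z] and
    [A^y + B ~> D].  Since the tensor of [C] is a coproduct, the second
    component splits as [A^y ~> D], i.e. [y ~> A ▷ D], and [B ~> D]; together
    with [y ~> [x, z]] this is a pair of [y ~> [x, z] × (A ▷ D)] and [B ~> D]. *)

From Stdlib Require Import ssreflect ssrfun.
Require Import Defs.
Local Open Scope cat_scope.

Section SemidirectClosed.
Variables (X : MonoidalCategory) (LX : LeftClosed X) (PX : FiniteProducts X).
Variables (C : Category) (KC : FiniteCoproducts C).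
Variables (Gam : StrongAction X (cocartesian KC)).
Variables (R : Functor (prodcat (opcat C) C) X) (HR : ActionHom Gam R).

(** The tensor of morphisms in [cocartesian KC] unfolds to [coproduct_map]; this lemma and the next
    restrict it to a summand in the naturality check. *)
Lemma coproduct_map_inj1 (A A' B B' : C) (f : A ~> A') (g : B ~> B') :
  coproduct_map KC f g ∘ inj1 KC A B = inj1 KC A' B' ∘ f.
Proof. exact: copairing_inj1. Qed.

Lemma coproduct_map_inj2 (A A' B B' : C) (f : A ~> A') (g : B ~> B') :
  coproduct_map KC f g ∘ inj2 KC A B = inj2 KC A' B' ∘ g.
Proof. exact: copairing_inj2. Qed.

(** Bridges [tens_left], which acts on the first summand through [actmm] at an identity, and
    [ah_nat_act], which speaks of [actm]. *)
Lemma actmm_idn (x y : X) (h : x ~> y) (A : C) :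
  actmm Gam h (idn A) = actm Gam h A.
Proof. by rewrite /actmm fmap_id comp_idl. Qed.

Definition semidirect_to (P Q S : prodcat X C)
    (f : tens_left (P : semidirect Gam) Q ~> S) :
  Q ~> semidirect_ihom LX PX R P.1 P.2 S :=
  (pairing PX (adj_to (ihom_adj LX P.1) f.1)
     (ah_to HR (f.2 ∘ inj1 KC (act Gam Q.1 P.2) Q.2)),
   f.2 ∘ inj2 KC (act Gam Q.1 P.2) Q.2).

Definition semidirect_from (P Q S : prodcat X C)
    (g : Q ~> semidirect_ihom LX PX R P.1 P.2 S) :
  tens_left (P : semidirect Gam) Q ~> S :=
  (adj_from (ihom_adj LX P.1) (proj1 PX _ _ ∘ g.1),
   copairing KC (ah_from HR (proj2 PX _ _ ∘ g.1)) g.2).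

Definition semidirect_adjunction (P : prodcat X C) :
  Adjunction (tens_left (P : semidirect Gam)) (semidirect_ihom LX PX R P.1 P.2).
Proof.
refine (@Build_Adjunction _ _ (tens_left (P : semidirect Gam))
  (semidirect_ihom LX PX R P.1 P.2)
  (semidirect_to P) (semidirect_from P) _ _ _ _).
- move=> Q S [f g]; rewrite /semidirect_from /=; congr (_, _).
  + by rewrite proj1_pairing adj_toK.
  (* A map out of the coproduct is the copairing of its two restrictions. *)
  + by rewrite proj2_pairing ah_toK; symmetry; apply: copairing_unique.
- move=> Q S [f g]; rewrite /semidirect_to /=; congr (_, _).
  + rewrite adj_fromK copairing_inj1 ah_fromK.
    by symmetry; apply: pairing_unique.
  + exact: copairing_inj2.
- move=> Q Q' S [h b] [f g]; rewrite /semidirect_to /=; congr (_, _).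
  + apply: pairing_ext; rewrite comp_assoc ?proj1_pairing ?proj2_pairing.
    * exact: adj_natl.
    (* Restricted to the first summand, tensoring [(h, b)] with the identity of [P] is
       [actm Gam h P.2], so precomposing with it becomes naturality of [ah_to] in the acting
       object. *)
    * refine (eq_trans _ (ah_nat_act HR _ _)); congr (ah_to HR _).
      refine (eq_trans (eq_sym (comp_assoc _ _ _)) (eq_trans _ (comp_assoc _ _ _))); congr (g ∘ _).
      rewrite -[in RHS]actmm_idn; exact: coproduct_map_inj1.
  + refine (eq_trans (eq_sym (comp_assoc _ _ _)) (eq_trans _ (comp_assoc _ _ _))).
    congr (g ∘ _); exact: coproduct_map_inj2.
- move=> Q S S' [h b] [f g]; rewrite /semidirect_to /=; congr (_, _).
  + apply: pairing_ext; rewrite comp_assoc ?proj1_pairing ?proj2_pairing.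
    * by rewrite -comp_assoc proj1_pairing adj_natr.
    * by rewrite -!comp_assoc proj2_pairing ah_nat_tgt.
  + by rewrite comp_assoc.
Defined.
End SemidirectClosed.

Theorem theorem8p2
    (X : MonoidalCategory) (LX : LeftClosed X) (PX : FiniteProducts X)
    (C : Category) (KC : FiniteCoproducts C)
    (Gam : StrongAction X (cocartesian KC))
    (R : Functor (prodcat (opcat C) C) X)
    (HR : ActionHom Gam R) :
  exists L : LeftClosed (semidirect Gam),
    forall (x : X) (A : C), ihom L (x, A) = semidirect_ihom LX PX R x A.
Proof.
exists (@Build_LeftClosed (semidirect Gam)
  (fun P => semidirect_ihom LX PX R P.1 P.2)
  (semidirect_adjunction _ LX PX _ _ _ _ HR)).
(* The internal hom was built as [semidirect_ihom] on the projections of [P], so at [(x, A)] the two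
   functors agree by computation. *)
by [].
Qed.
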